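(* Let $n$ be a natural number, $n\ge 1$. The sum of the degrees of the irreducible complex representations of the symmetric group $\mathfrak{S}_n$ (up to isomorphism) is $$1+\sum_{(i_1,i_2,\ldots,i_n)}\frac{n!}{\prod_{l=1}^{\delta_n}\prod_{j=1}^{i_l}\left[(i_l-j)+1+\Gamma_l^j\right]},$$ where the sum runs over all tuples of integers $(i_1,\ldots,i_n)$ with $i_1+i_2+\cdots+i_n=n$ and $n>i_1\geq i_2\geq\cdots\geq i_n\geq 0$, and where $\delta_n$ and $\Gamma_l^j$ are the quantities attached to the tuple $(i_1,\dots,i_n)$ defined in the context.
   Context: For a tuple $(i_1,\ldots,i_n)$ of non-negative integers and indices $j,k,l$, set $\Omega_j(i_k)=1$ if $i_k\geq j$ and $\Omega_j(i_k)=0$ otherwise; $\Lambda_k=1$ if $i_k>0$ and $\Lambda_k=0$ otherwise; $\delta_n=\sum_{k=1}^{n}\Lambda_k$; $\Gamma_l^j=\sum_{k=l+1}^{n}\Omega_j(i_k)$ if $l+1\leq n$, and $\Gamma_l^j=0$ otherwise. (All of these depend on the tuple.) *)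

(* Defs.v *)
From HB Require Import structures.
From mathcomp Require Import all_boot all_order all_fingroup all_algebra.
From mathcomp Require Import all_character.
From mathcomp Require Import complex reals.

Set Implicit Arguments.
Unset Strict Implicit.
Unset Printing Implicit Defensive.

Import GRing.Theory Num.Theory.

Section TupleQuantities.

(* Entries in 'I_n.+1 make the tuple type finite; no tuple of non-negative
   integers with sum n is lost. *)
Variables (n : nat) (t : n.-tuple 'I_n.+1).

(* k is 1-based: entry k is i_k for 1 <= k <= n. *)
Definition entry (k : nat) : nat := nth 0 [seq val i | i <- t] k.-1.

Definition Omega (j k : nat) : nat := j <= entry k.

Definition Lambda (k : nat) : nat := 0 < entry k.

Definition delta : nat := \sum_(1 <= k < n.+1) Lambda k.

(* The range is empty, and the sum 0, when l + 1 > n. *)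
Definition Gamma (j l : nat) : nat := \sum_(l.+1 <= k < n.+1) Omega j k.

(* In each factor j <= i_l, so the subtraction does not truncate. *)
Definition denominator : nat :=
  \prod_(1 <= l < delta.+1) \prod_(1 <= j < (entry l).+1)
    ((entry l - j) + 1 + Gamma j l).

Definition admissible : bool :=
  [&& \sum_(1 <= k < n.+1) entry k == n,
      entry 1 < n
    & [forall k : 'I_n, (0 < k) ==> (entry k.+1 <= entry k)]].

End TupleQuantities.

(* DecSocleType (regular_repr F G) has one element per isomorphism class of
   irreducible F-representations of G when the characteristic of F does not
   divide #|G| (see irr_comp and rsim_irr_comp_pchar); irr_degree W is the
   dimension of the representation irr_repr W. *)
Definition irr_degree_sum (F : decFieldType) (gT : finGroupType)
    (G : {group gT}) : nat :=
  \sum_(W : DecSocleType (regular_repr F G)) irr_degree W.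

(* Main.v *)
Require Import Defs.
From HB Require Import structures.
From mathcomp Require Import all_boot all_order all_fingroup all_algebra.
From mathcomp Require Import all_character.
From mathcomp Require Import complex reals.
From mathcomp Require Import pgroup ring zify.
Import Order.TTheory GRing.Theory Num.Theory.
Local Open Scope ring_scope.

Set Implicit Arguments.
Unset Strict Implicit.
Unset Printing Implicit Defensive.

(* Both sides count the involutions of S_n, the identity included.

   Degrees: the group algebra gives |G| #{g : g^2 = 1} = sum_W d_W sum_g
   chi_W(g^2), so it suffices that every irreducible W has Frobenius-Schur
   indicator 1.  This goes by induction along H = S_(n-1) < G = S_n.  Every g
   in G is inverted by some h in H, hence for g in G the pairs (h, g) with
   g^h = g and with g^h = g^-1 are equinumerous; expanding both counts over
   the regular character gives
     sum_W <chi_W, chi_W>_H = sum_W nu_W nu_H(W),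
   where nu_H(W) is the mean of chi_W(h^2) over H.  As 0 < nu_H(W) <=
   <chi_W, chi_W>_H by induction and nu_W = +-1, all nu_W equal 1.

   Hooks: with the beta-numbers l_i = lambda_i + n - i, the quotient n!/hooks
   is n! prod_(i<j) (l_i - l_j) / prod_i l_i!.  Writing F for this expression
   without n!, one has |lambda| F(lambda) = sum of F over the partitions
   obtained by removing a box, and F(lambda) = sum of F over those obtained by
   adding one.  Since a partition has one more addable than removable box, the
   sums G_k of F over the partitions of k satisfy (k+1) G_(k+1) = G_k +
   G_(k-1), which is the recursion for the numbers of involutions. *)

(** * Averages over a group *)

(** Cancelling the full-rank factors of [A = col_base A *m row_base A] in [A *m A = A] leaves
    [row_base A *m col_base A = 1]. *)
Lemma mxtrace_idem (F : fieldType) n (A : 'M[F]_n) :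
  A *m A = A -> \tr A = (\rank A)%:R.
Proof.
move=> idA; rewrite -[X in \tr X]mulmx_base mxtrace_mulC.
suff -> : row_base A *m col_base A = 1%:M by rewrite mxtrace1.
apply: (row_full_inj (col_base_full A)); apply: (row_free_inj (row_base_free
  A)).
by rewrite mulmx1 mulmxA mulmx_base -mulmxA mulmx_base idA.
Qed.

(** The double sum is the trace of [f] in the basis of elementary matrices, hence the rank of a
    projector. *)
Lemma lin_idem_trace (F : fieldType) m n (f : 'M[F]_(m, n) -> 'M[F]_(m, n)) :
    linear f -> (forall X, f (f X) = f X) ->
  exists r : nat, \sum_i \sum_j f (delta_mx i j) i j = r%:R.
Proof.
move=> lin_f idf.
pose fL : {linear 'M[F]_(m, n) -> 'M[F]_(m, n)} :=
  HB.pack f (GRing.isLinear.Build _ _ _ _ f lin_f).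
exists (\rank (lin_mx fL)); rewrite -mxtrace_idem; last first.
  apply/row_matrixP=> k; rewrite !rowE mulmxA -[delta_mx 0 k]vec_mxK.
  by rewrite !mul_vec_lin /= idf.
rewrite /mxtrace pair_big /=.
rewrite [RHS](reindex (uncurry (@mxvec_index m n))) /=; last first.
  exact: curry_mxvec_bij.
apply: eq_bigr => -[i j] _ /=.
have := congr1 (fun v : 'rV_(m * n) => v 0 (mxvec_index i j)) 
  (mul_vec_lin fL (delta_mx i j)).
by rewrite mxvec_delta -rowE mxvecE mxE => ->.
Qed.

Lemma mul_mx_delta_mx (R : pzRingType) m n p q (A : 'M[R]_(m, n)) (B :
  'M[R]_(p, q)) i j a b :
  (A *m delta_mx i j *m B) a b = A a i * B j b.
Proof.
rewrite mxE (bigD1 j) //= mxE (bigD1 i) //= !mxE !eqxx mulr1.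
rewrite !big1 ?addr0 // => k /negPf nk.
  by rewrite mxE big1 ?mul0r // => l _; rewrite mxE nk andbF mulr0.
by rewrite mxE nk mulr0.
Qed.

Lemma trace_delta_mx (R : pzRingType) n (i j : 'I_n) :
  \tr (delta_mx i j : 'M[R]_n) = (i == j)%:R.
Proof.
rewrite /mxtrace (bigD1 i) //= big1 ?addr0 => [|k /negPf nki].
  by rewrite mxE eqxx.
by rewrite mxE nki.
Qed.

Section Average.

Variables (F : numClosedFieldType) (gT : finGroupType) (G : {group gT}).

Lemma natG_neq0 : #|G|%:R != 0 :> F.
Proof. by rewrite pnatr_eq0 -lt0n cardG_gt0. Qed.

Lemma num_pchar'_group : ([pchar F]^'.-group G)%g.
Proof.
by apply/pgroupP=> p _ _; rewrite inE /= pchar_num.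
Qed.

Section OneRepr.

Variables (n : nat) (rG : mx_representation F G n).

(* [s] and [t] are the dimensions of the spaces of symmetric and alternating
   invariant bilinear forms, obtained as traces of the averaging projectors. *)
Lemma bilinear_invariants :
  exists s t : nat,
    \sum_(g in G) \tr (rG g) ^+ 2 = (#|G| * (s + t))%:R /\
    \sum_(g in G) \tr (rG (g ^+ 2)%g) = #|G|%:R * (s%:R - t%:R).
Proof.
(* The factor [#|G|^-1] averages over the group and [1 / 2] symmetrizes: for [e = 1] and [e = -1],
   [T e] projects onto the invariant [X] with [e *: X^T = X]. *)
have [c defc] : {c : F | c = #|G|%:R^-1 / 2} by exists (#|G|%:R^-1 / 2).
pose T (e : F) (X : 'M[F]_n) : 'M[F]_n :=
  c *: \sum_(g in G) rG g *m (X + e *: X^T) *m (rG g)^T.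
have linT e : linear (T e).
  move=> a X Y; rewrite /T scalerA [a * _]mulrC -scalerA -scalerDr;
    congr (_ *: _).
  rewrite scaler_sumr -big_split; apply: eq_bigr => g _ /=.
  rewrite scalemxAl scalemxAr -mulmxDl -mulmxDr; congr (_ *m _ *m _).
  rewrite linearP /=.
  by rewrite !scalerDr !scalerA addrACA [e * a]mulrC.
have trT e : 2 * #|G|%:R * \sum_(i < n) \sum_(j < n) T e (delta_mx i j) i j
    = \sum_(g in G) \tr (rG g) ^+ 2 + e * \sum_(g in G) \tr (rG (g ^+ 2)%g).
  pose E g (i j : 'I_n) := rG g *m (delta_mx i j + e *: (delta_mx i j)^T) *m
    (rG g)^T.
  transitivity (\sum_(i < n) \sum_(j < n) \sum_(g in G) E g i j i j).
    rewrite mulr_sumr; apply: eq_bigr => i _; rewrite mulr_sumr.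
    apply: eq_bigr => j _; rewrite mxE summxE mulrA defc.
    by rewrite -[2 * _ * _]mulrA [_ * (_ / 2)]mulrA divff ?natG_neq0 // mul1r
      divff ?pnatr_eq0 // mul1r.
  (* Summed over [i] and [j], the first product gives the squared trace and the second the trace of
     the square. *)
  have EE g i j : E g i j i j = rG g i i * rG g j j + e * (rG g i j * rG g j i).
    rewrite /E mulmxDr mulmxDl -scalemxAr -scalemxAl trmx_delta mxE
      mul_mx_delta_mx.
    by rewrite [X in _ + X]mxE mul_mx_delta_mx !mxE.
  transitivity (\sum_(i < n) \sum_(g in G) \sum_(j < n) E g i j i j).
    by apply: eq_bigr => i _; rewrite exchange_big.
  rewrite exchange_big /= mulr_sumr -big_split; apply: eq_bigr => g Gg /=.
  rewrite expr2 expgS expg1 repr_mxM // /mxtrace mulr_suml mulr_sumr -big_split.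
  apply: eq_bigr => i _ /=; rewrite mulr_sumr mxE mulr_sumr -big_split.
  by apply: eq_bigr => j _; rewrite EE.
have idT e X : e * e = 1 -> T e (T e X) = T e X.
  move=> e2; set Y := T e X.
  have eYt : e *: Y^T = Y.
    rewrite /Y /T linearZ /= scalerA [e * _]mulrC -scalerA; congr (_ *: _).
    rewrite linear_sum /= scaler_sumr; apply: eq_bigr => g _.
    rewrite !trmx_mul trmxK mulmxA scalemxAl scalemxAr; congr (_ *m _ *m _).
    by rewrite linearD linearZ /= trmxK scalerDr scalerA e2 scale1r addrC.
  have rYr h : h \in G -> rG h *m Y *m (rG h)^T = Y.
    move=> Gh; rewrite /Y /T -scalemxAr -scalemxAl; congr (_ *: _).
    rewrite mulmx_sumr mulmx_suml.
    rewrite [RHS](reindex_inj (mulgI h)) /=; apply: eq_big => g.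
      by rewrite groupMl.
    by move=> Gg; rewrite repr_mxM // trmx_mul !mulmxA.
  rewrite {1}/T eYt (eq_bigr (fun=> Y + Y)); last first.
    by move=> g Gg; rewrite mulmxDr mulmxDl rYr.
  rewrite sumr_const -scaler_nat scalerA -mulr2n -scaler_nat scalerA.
  by rewrite defc [_ / 2 * _]mulrAC mulVf ?natG_neq0 // mul1r mulVf ?pnatr_eq0
    // scale1r.
have [s trs] := lin_idem_trace (linT 1) (fun X => idT 1 X (mulr1 1)).
have [t trt] := lin_idem_trace (linT (-1)) (fun X =>
  idT (-1) X (etrans (mulrNN 1 1) (mulr1 1))).
have := trT 1; have := trT (-1); rewrite {}trs {}trt mul1r mulN1r.
set a := \sum_(g in G) _; set b := \sum_(g in G) _ => eqt eqs.
exists s, t; split; apply: (@mulfI _ 2); rewrite ?pnatr_eq0 //.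
  rewrite natrM natrD mulrA mulrDr eqs eqt; ring.
by rewrite mulrA mulrBr eqs eqt; ring.
Qed.

Hypothesis irrG : mx_irreducible rG.

Let splitG : group_splitting_field F G.
Proof. exact: group_closure_closed_field. Qed.

Lemma irr_degree_neq0 : n%:R != 0 :> F.
Proof. by rewrite pnatr_eq0 -lt0n; case/mx_irrP: irrG. Qed.

(** Schur's lemma: the average commutes with [G], so it is scalar, and its trace determines the
    scalar. *)
Lemma irr_average X :
  \sum_(g in G) rG g *m X *m rG g^-1%g = (#|G|%:R * \tr X / n%:R)%:M.
Proof.
set M := \sum_(g in G) _.
have trM : \tr M = #|G|%:R * \tr X.
  rewrite /M linear_sum (eq_bigr (fun=> \tr X)) /= ?sumr_const ?mulr_natl //.
  by move=> g Gg; rewrite mxtrace_mulC mulmxA -repr_mxM ?groupV // mulVg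
    repr_mx1 mul1mx.
have /is_scalar_mxP[a defM] : is_scalar_mx M.
  apply: (mx_abs_irr_cent_scalar (splitG irrG)); apply/centgmxP=> h Gh.
  rewrite mulmx_sumr mulmx_suml [LHS](reindex_inj (mulgI h)) /=.
  apply: eq_big => g; first by rewrite groupMl.
  rewrite groupMl // => Gg; rewrite invMg !repr_mxM ?groupV // -!mulmxA;
    congr (_ *m (_ *m (_ *m _))).
  by rewrite -repr_mxM ?groupV // mulVg repr_mx1 mulmx1.
rewrite -trM defM mxtrace_scalar -[a *+ n]mulr_natr mulfK //;
  exact: irr_degree_neq0.
Qed.

(** Squaring commutes with conjugation, so the sum is central and Schur's lemma applies. *)
Lemma irr_square_sum :
  \sum_(g in G) rG (g ^+ 2)%g = (\sum_(g in G) \tr (rG (g ^+ 2)%g) / n%:R)%:M.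
Proof.
set M := \sum_(g in G) _.
have /is_scalar_mxP[a defM] : is_scalar_mx M.
  apply: (mx_abs_irr_cent_scalar (splitG irrG)); apply/centgmxP=> h Gh.
  rewrite mulmx_sumr mulmx_suml [RHS](reindex_acts 'J _ Gh) ?astabsJ ?normG //.
  by apply: eq_bigr => g Gg; rewrite -!repr_mxM ?groupX ?groupJ //= -conjXg
    -conjgC.
rewrite -mulr_suml -[X in (X / _)%:M]linear_sum /= -/M defM mxtrace_scalar.
by rewrite -[a *+ n]mulr_natr mulfK //; exact: irr_degree_neq0.
Qed.

(** First orthogonality relation, read off from [irr_average] at the elementary matrices. *)
Lemma irr_norm : \sum_(g in G) \tr (rG g) * \tr (rG g^-1%g) = #|G|%:R.
Proof.
transitivity (\sum_(i < n) \sum_(j < n)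
    (\sum_(g in G) rG g *m delta_mx i j *m rG g^-1%g) i j).
  transitivity (\sum_(i < n) \sum_(g in G) \sum_(j < n) (rG g *m delta_mx i j
    *m rG g^-1%g) i j); last first.
    apply: eq_bigr => i _; rewrite exchange_big; apply: eq_bigr => j _ /=.
    by rewrite summxE.
  rewrite [RHS]exchange_big /=; apply: eq_bigr => g Gg.
  rewrite /mxtrace mulr_suml; apply: eq_bigr => i _; rewrite mulr_sumr.
  by apply: eq_bigr => j _; rewrite mul_mx_delta_mx.
transitivity (\sum_(i < n) #|G|%:R / n%:R : F); last first.
  rewrite sumr_const card_ord -[LHS]mulr_natr mulfVK //; exact: irr_degree_neq0.
apply: eq_bigr => i _; under eq_bigr do rewrite irr_average.
rewrite (bigD1 i) //= big1 ?addr0 => [|j /negPf nji].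
  by rewrite mxE eqxx mulr1n trace_delta_mx eqxx mulr1.
by rewrite mxE eq_sym nji.
Qed.

End OneRepr.

Section Regular.

Variable sG : irrType F G.

Lemma sum_irr_regular x : x \in G ->
  \sum_(W : sG) (irr_degree W)%:R * \tr (irr_repr W x) = #|G|%:R *+ (x == 1%g).
Proof.
move=> Gx; transitivity (\tr (regular_repr F G x)).
  rewrite (mxtrace_regular_pchar sG num_pchar'_group
    (@group_closure_closed_field F gT G)) //.
  by apply: eq_bigr => W _; rewrite mulr_natl.
have [-> | ntx] := eqVneq x 1%g; first by rewrite repr_mx1 mxtrace1.
rewrite [\tr _]big1 // => i _; rewrite 2!mxE /=.
rewrite -(inj_eq enum_val_inj) gring_indexK ?groupM ?enum_valP //.
by rewrite eq_mulVg1 mulKg (negbTE ntx).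
Qed.

Lemma sum_irr_square :
  \sum_(W : sG) (irr_degree W)%:R * (\sum_(g in G) \tr (irr_repr W (g ^+ 2)%g))
    = (#|G| * #|[set g in G | (g ^+ 2 == 1)%g]|)%:R.
Proof.
under eq_bigr do rewrite mulr_sumr.
rewrite exchange_big /= natrM -sum1dep_card natr_sum mulr_sumr big_mkcondr.
apply: eq_bigr => g Gg; rewrite sum_irr_regular ?groupX //.
by case: eqP; rewrite ?mulr1.
Qed.

Variable H : {group gT}.
Hypothesis sHG : H \subset G.
Hypothesis invG : forall g, g \in G -> exists2 h, h \in H & (g ^ h = g^-1)%g.

Lemma card_inverting_pairs :
  (\sum_(h in H) \sum_(g in G) (h * g * h^-1 * g^-1 == 1)%g =
   \sum_(h in H) \sum_(g in G) (g ^+ 2 * h ^+ 2 == 1)%g)%N.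
Proof.
transitivity (\sum_(h in H) \sum_(g in G) (h * g * h^-1 * g == 1)%g)%N;
  last first.
  (* Replacing [g] by [g * h] turns [h * g * h^-1 * g] into a conjugate of [g ^+ 2 * h ^+ 2]. *)
  apply: eq_bigr => h Hh; rewrite [LHS](reindex_inj (mulIg h)) /=.
  apply: eq_big => g; first by rewrite groupMr // (subsetP sHG).
  move=> _; congr (nat_of_bool _).
  by rewrite -(conjg_eq1 _ h) /conjg !mulgA mulVg mul1g mulgK.
rewrite exchange_big [RHS]exchange_big; apply: eq_bigr => g Gg /=.
(* For fixed [g], translation by [k] matches the [h] that centralize [g] with those that invert
   it. *)
have [k Hk gk] := invG Gg.
rewrite [RHS](reindex_inj (mulgI k^-1%g)) /=; apply: eq_big => h.
  by rewrite groupMl ?groupV.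
move=> Hh; congr (nat_of_bool _); rewrite -(conjg_eq1 _ k) /conjg invMg invgK.
have gk' : (k * g = g^-1 * k)%g.
  by rewrite [RHS]conjgC conjVg gk invgK.
by rewrite -!mulgA gk'.
Qed.

(* Both sides are [#|G|] times the number of pairs in [card_inverting_pairs]. *)
Lemma irr_restriction_balance :
  \sum_(W : sG) \sum_(h in H) \tr (irr_repr W h) * \tr (irr_repr W h^-1%g) *
    #|G|%:R =
  \sum_(W : sG) (\sum_(g in G) \tr (irr_repr W (g ^+ 2)%g)) *
                (\sum_(h in H) \tr (irr_repr W (h ^+ 2)%g)).
Proof.
have irrW (W : sG) : mx_irreducible (irr_repr W) by exact: socle_irr.
have d0 W := irr_degree_neq0 (irrW W).
have pairs1 : \sum_(h in H) \sum_(g in G) #|G|%:R *+ (h * g * h^-1 * g^-1 ==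
  1)%g =
    \sum_(W : sG) \sum_(h in H) \tr (irr_repr W h) * \tr (irr_repr W h^-1%g) *
      #|G|%:R.
  rewrite [RHS]exchange_big; apply: eq_bigr => h /(subsetP sHG) Gh.
  transitivity (\sum_(g in G) \sum_(W : sG) 
      (irr_degree W)%:R * \tr (irr_repr W (h * g * h^-1 * g^-1)%g)).
    by apply: eq_bigr => g Gg; rewrite sum_irr_regular // !groupM ?groupV.
  rewrite exchange_big; apply: eq_bigr => W _; rewrite -mulr_sumr.
  (* The inner sum is the conjugation average of [irr_repr W h^-1], to which [irr_average]
     applies. *)
  transitivity ((irr_degree W)%:R * \tr (irr_repr W h *m
      \sum_(g in G) irr_repr W g *m irr_repr W h^-1%g *m irr_repr W g^-1%g)).
    rewrite mulmx_sumr linear_sum; congr (_ * _); apply: eq_bigr => g Gg /=.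
    by rewrite !repr_mxM ?groupM ?groupV // !mulmxA.
  rewrite irr_average // mul_mx_scalar linearZ /=.
  by field; exact: d0.
have pairs2 : \sum_(h in H) \sum_(g in G) #|G|%:R *+ (g ^+ 2 * h ^+ 2 == 1)%g =
    \sum_(W : sG) (\sum_(g in G) \tr (irr_repr W (g ^+ 2)%g)) *
                  (\sum_(h in H) \tr (irr_repr W (h ^+ 2)%g)).
  under [RHS]eq_bigr do rewrite mulr_sumr.
  rewrite [RHS]exchange_big; apply: eq_bigr => h /(subsetP sHG) Gh.
  transitivity (\sum_(g in G) \sum_(W : sG) 
      (irr_degree W)%:R * \tr (irr_repr W (g ^+ 2 * h ^+ 2)%g)).
    by apply: eq_bigr => g Gg; rewrite sum_irr_regular // groupM ?groupX.
  rewrite exchange_big; apply: eq_bigr => W _; rewrite -mulr_sumr.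
  transitivity ((irr_degree W)%:R * \tr (
      (\sum_(g in G) irr_repr W (g ^+ 2)%g) *m irr_repr W (h ^+ 2)%g)).
    rewrite mulmx_suml linear_sum; congr (_ * _); apply: eq_bigr => g Gg /=.
    by rewrite repr_mxM ?groupX.
  rewrite irr_square_sum // mul_scalar_mx linearZ /= mulrA; congr (_ * _).
  by rewrite -mulr_suml mulrCA mulfV ?mulr1.
rewrite -pairs1 -pairs2.
under eq_bigr do rewrite sumrMnr; under [RHS]eq_bigr do rewrite sumrMnr.
by rewrite !sumrMnr card_inverting_pairs.
Qed.

End Regular.

End Average.

(** * Positivity of indicators, by induction along a subgroup *)

(** * The Frobenius-Schur indicator of a symmetric group *)

(** Stated for all nonzero representations, since it is applied to restrictions of irreducible
    ones. *)
Definition positive_squares (F : numClosedFieldType) (gT : finGroupType)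
    (G : {group gT}) : Prop :=
  forall n (rG : mx_representation F G n), (0 < n)%N ->
  0 < \sum_(g in G) \tr (rG (g ^+ 2)%g).

(** Induction on the dimension: the trace splits over a simple submodule and its quotient, which may
    be zero. *)
Lemma positive_squares_irr (F : numClosedFieldType) (gT : finGroupType)
    (G : {group gT}) :
    (forall n (rG : mx_representation F G n), mx_irreducible rG ->
       0 < \sum_(g in G) \tr (rG (g ^+ 2)%g)) ->
  positive_squares F G.
Proof.
move=> posI n; have [m] := ubnP n; elim: m n => // m IHm n lt_n_m rG n_gt0.
have nz1 : (1%:M : 'M[F]_n) != 0 by rewrite -mxrank_eq0 mxrank1 -lt0n.
have [U simU _] := dec_mxsimple_exists (mxmodule1 rG) nz1.
have modU := mxsimple_module simU.
under eq_bigr do rewrite -(mxtrace_sub_fact_mod modU).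
rewrite big_split /=; apply: ltr_wpDr; last first.
  by apply: posI; apply/submod_mx_irr.
have [k0 | k_gt0] := posnP (\rank (cokermx U)).
  rewrite big1 // => g _; rewrite /mxtrace big1 // => i _.
  by case: i => i lt_i; exfalso; rewrite k0 in lt_i.
apply/ltW/IHm => //; rewrite mxrank_coker.
have : (0 < \rank U)%N by rewrite lt0n mxrank_eq0; case: simU.
by move: lt_n_m n_gt0; lia.
Qed.

Section Step.

Variables (F : numClosedFieldType) (gT : finGroupType) (G H : {group gT}).
Hypothesis sHG : H \subset G.
Hypothesis invG : forall g, g \in G -> exists2 h, h \in H & (g ^ h = g^-1)%g.
Hypothesis posH : positive_squares F H.

Lemma mxtrace_conj_inv (K : {group gT}) n (rK : mx_representation F K n) g h :
  g \in K -> h \in K -> (g ^ h = g^-1)%g -> \tr (rK g^-1%g) = \tr (rK g).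
Proof.
move=> Kg Kh <-; rewrite /conjg !repr_mxM ?groupM ?groupV //.
by rewrite mxtrace_mulC -mulmxA -repr_mxM ?groupV // mulgV repr_mx1 mulmx1.
Qed.

Lemma irr_repr_indicator (sG : irrType F G) (W : sG) :
  \sum_(g in G) \tr (irr_repr W (g ^+ 2)%g) = #|G|%:R.
Proof.
have realG (V : sG) g : g \in G -> \tr (irr_repr V g^-1%g) = \tr (irr_repr V g)
  :> F.
  move=> Gg; have [h Hh gh] := invG Gg.
 exact: (mxtrace_conj_inv (irr_repr V) Gg (subsetP sHG _ Hh) gh).
(* The character is invariant under inversion, so [irr_norm] forces [s + t = 1]. *)
have signG (V : sG) : \sum_(g in G) \tr (irr_repr V (g ^+ 2)%g) = #|G|%:R \/
               \sum_(g in G) \tr (irr_repr V (g ^+ 2)%g) = - #|G|%:R.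
  have [s [t [eq_st ->]]] := bilinear_invariants (irr_repr V).
  have irrV : mx_irreducible (irr_repr V) := socle_irr V.
  have := irr_norm irrV.
  rewrite (eq_bigr (fun g => \tr (irr_repr V g) ^+ 2)); last first.
    by move=> g Gg; rewrite expr2; congr (_ * _); exact: realG.
  rewrite eq_st natrM => eqG.
  have {eqG eq_st}/eqP : (s + t)%:R = 1 :> F.
    by apply: (mulfI (natG_neq0 F G)); rewrite mulr1.
  rewrite pnatr_eq1; case: s t => [|[|s]] [|[|t]] // _; [right | left].
    by rewrite sub0r mulrN1.
  by rewrite subr0 mulr1.
pose a (V : sG) := \sum_(h in H) \tr (irr_repr V h) * \tr (irr_repr V h^-1%g).
pose b (V : sG) := \sum_(h in H) \tr (irr_repr V (h ^+ 2)%g).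
have b_gt0 V : 0 < b V.
  exact: (posH (subg_repr (irr_repr V) sHG) (irr_degree_gt0 V)).
(* Over [H] this is [s - t <= s + t], up to the factor [#|H|]. *)
have ab V : b V <= a V.
  have [s [t [eq_a eq_b]]] := bilinear_invariants (subg_repr (irr_repr V) sHG).
  rewrite /b eq_b /a (eq_bigr (fun h => \tr (irr_repr V h) ^+ 2)); last first.
    by move=> h /(subsetP sHG) Gh; rewrite expr2; congr (_ * _); exact: realG.
  rewrite eq_a natrM natrD ler_pM2l ?ltr0n ?cardG_gt0 // lerD2l.
  by rewrite (le_trans _ (ler0n _ _)) // oppr_le0 ler0n.
pose nu (V : sG) := \sum_(g in G) \tr (irr_repr V (g ^+ 2)%g).
have G_gt0 : 0 < #|G|%:R :> F by rewrite ltr0n cardG_gt0.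
have term_ge0 V : 0 <= a V * #|G|%:R - nu V * b V.
  rewrite /nu; case: (signG V) => ->.
    by rewrite [a V * _]mulrC -mulrBr mulr_ge0 ?subr_ge0 // ltW.
  by rewrite mulNr opprK addr_ge0 // mulr_ge0 ?ltW // (lt_le_trans (b_gt0 V)).
(* Nonnegative terms with sum zero all vanish, whereas indicator -1 would make the term
   [#|G| * (a V + b V)], which is positive. *)
have sum0 : \sum_V (a V * #|G|%:R - nu V * b V) == 0.
  rewrite sumrB subr_eq0; apply/eqP; rewrite -(irr_restriction_balance sG sHG
    invG).
  by apply: eq_bigr => V _; rewrite mulr_suml.
have := sum0; rewrite psumr_eq0 // => /allP/(_ W); rewrite mem_index_enum.
move=> /(_ isT)/=; rewrite /nu; case: (signG W) => // ->.
rewrite mulNr opprK gt_eqF // addr_gt0 // mulr_gt0 //.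
exact: lt_le_trans (ab W).
Qed.

Lemma positive_squares_step : positive_squares F G.
Proof.
apply: positive_squares_irr => n rG irrG.
pose sG : irrType F G := DecSocleType (regular_repr F G).
have sim := rsim_irr_comp_pchar sG (num_pchar'_group F G) irrG.
under eq_bigr => g Gg do rewrite (mxtrace_rsim sim) ?groupX //.
by rewrite irr_repr_indicator ltr0n cardG_gt0.
Qed.

Lemma sum_irr_degree_involutions (sG : irrType F G) :
  (\sum_(W : sG) irr_degree W = #|[set g in G | (g ^+ 2 == 1)%g]|)%N.
Proof.
have G_gt0 : 0 < #|G|%:R :> F by rewrite ltr0n cardG_gt0.
apply/eqP; rewrite -(eqr_nat F) -(inj_eq (mulfI (lt0r_neq0 G_gt0))); apply/eqP.
rewrite -[RHS]natrM -(sum_irr_square sG) natr_sum mulr_sumr.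
by apply: eq_bigr => W _; rewrite irr_repr_indicator mulrC.
Qed.

End Step.

(** * Inverting permutations and the number of involutions *)

Fixpoint telephone n : nat :=
  if n is m.+1 then
    if m is k.+1 then (telephone m + m * telephone k)%N else 1%N
  else 1%N.

Section Involutions.

Local Open Scope group_scope.
Variable T : finType.
Implicit Types (s : {perm T}) (A : {set T}).

(** Each cycle of [s] is reflected about a base point [c], sending [s^i c] to [s^-i c]; [x] is the
    base point of its own cycle, hence fixed. *)
Lemma inverting_perm s x :
  exists k : {perm T},
    [/\ k x = x, s ^ k = s^-1 & forall A, perm_on A s -> perm_on A k].
Proof.
pose c y := if x \in porbit s y then x else odflt y [pick z in porbit s y].
have cP y : y \in porbit s (c y).
  rewrite /c porbit_sym; case: ifP => // _.
  by case: pickP => [z //|/(_ y)]; rewrite /= porbit_id.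
have c_eq y z : porbit s y = porbit s z -> c y = c z.
  rewrite /c => ->; case: ifP => // _; case: pickP => //= /(_ z).
  by rewrite porbit_id.
have exf y : exists i, y == (s ^+ i) (c y).
  by have /porbitP[i yi] := cP y; exists i; apply/eqP.
pose f y := (s ^- xchoose (exf y)) (c y).
(* The exponent is determined only modulo the cycle length; the reflected point does not depend on
   the choice. *)
have fE y i : y = (s ^+ i) (c y) -> f y = (s ^- i) (c y).
  move=> yi; rewrite /f; set j := xchoose _.
  have yj : y = (s ^+ j) (c y) by apply/eqP/(xchooseP (exf y)).
  apply: (@perm_inj _ (s ^+ (i + j))); rewrite -!permM [in RHS]expgD mulKg.
  by rewrite addnC expgD mulKg -yi -yj.
have fP y : exists2 i, y = (s ^+ i) (c y) & f y = (s ^- i) (c y).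
  by have /eqP yi := xchooseP (exf y); exists (xchoose (exf y)).
have porb_f y : porbit s (f y) = porbit s y.
  have [i yi ->] := fP y; rewrite -expVgn -[LHS]porbitV porbit_perm porbitV.
  by rewrite [in RHS]yi porbit_perm.
have fK : involutive f.
  move=> y; have [i yi fyi] := fP y; have [k fyk ->] := fP (f y).
  rewrite (c_eq _ _ (porb_f y)) in fyk *.
  apply: (@perm_inj _ (s ^+ k)); rewrite -permM mulVg perm1.
  by rewrite [in RHS]yi -permM -expgD addnC expgD permM -fyk fyi -permM mulVg
    perm1.
have fs y : f (s y) = s^-1 (f y).
  have [i yi ->] := fP y; have csy : c (s y) = c y.
    by apply: c_eq; apply/eqP; rewrite eq_porbit_mem (mem_porbit s 1 y).
  rewrite (fE _ i.+1); first by rewrite csy expgS invMg permM.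
  by rewrite csy expgSr permM -yi.
exists (perm (inv_inj fK)); split=> [||A sA].
- have cx : c x = x by rewrite /c porbit_id.
  by rewrite permE (fE x 0) ?cx // expg0 ?invg1 perm1.
- apply: (mulgI (perm (inv_inj fK))); rewrite -conjgC; apply/permP=> y.
  by rewrite !permM !(permE (inv_inj fK)) fs.
apply/subsetP=> y; rewrite inE permE; apply: contraR => yA.
have sXy i : (s ^+ i) y = y by apply/permX_fix/(out_perm sA).
have cy : c y = y.
  have /porbitP[i ->] : c y \in porbit s y by rewrite porbit_sym.
  exact: sXy.
have [i _ ->] := fP y.
by apply/eqP; rewrite cy -{1}(sXy i) -permM mulgV perm1.
Qed.

Lemma Sym_inverting A x s :
  s \in Sym A -> exists2 k, k \in Sym (A :\ x) & s ^ k = s^-1.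
Proof.
rewrite inE => sA; have [k [kx sk kA]] := inverting_perm s x.
exists k => //; rewrite inE; apply/subsetP=> y; rewrite !inE => ky.
apply/andP; split; first by apply: contraNneq ky => ->; rewrite kx.
by apply: (subsetP (kA A sA)); rewrite inE.
Qed.

Lemma sub_Sym A x : Sym (A :\ x) \subset Sym A.
Proof.
apply/subsetP=> s; rewrite !inE => /subset_trans; apply; exact: subD1set.
Qed.

Definition involutions A : {set {perm T}} := [set s in Sym A | s ^+ 2 == 1].

Lemma card_involutions_fix A x :
  #|[set s in involutions A | s x == x]| = #|involutions (A :\ x)|.
Proof.
apply: eq_card => s; rewrite !inE andbAC; congr (_ && _).
apply/andP/idP => [[sA /eqP sx] | sA].
  apply/subsetP=> y; rewrite !inE => sy; apply/andP; split.
    by apply: contraNneq sy => ->; rewrite sx.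
  by apply: (subsetP sA); rewrite inE.
split; first exact: subset_trans sA (subD1set _ _).
by apply/eqP/(out_perm sA); rewrite !inE eqxx.
Qed.

(** An involution taking [x] to [y] commutes with [tperm x y]; multiplying by this transposition is
    the bijection. *)
Lemma card_involutions_swap A x y : x \in A -> y \in A -> y != x ->
  #|[set s in involutions A | s x == y]| = #|involutions (A :\ x :\ y)|.
Proof.
move=> Ax Ay nyx; rewrite -[RHS](card_imset _ (mulIg (tperm x y))).
apply: eq_card => s; apply/idP/imsetP => [|[h]]; rewrite !inE.
  case/andP=> /andP[sA s2] /eqP sx.
  have sy : s y = x.
    by move/eqP/permP/(_ x): s2; rewrite expgS expg1 permM sx perm1.
  have cst : s * tperm x y = tperm x y * s.
    by rewrite [RHS]conjgC tpermJ sx sy tpermC.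
  exists (s * tperm x y); last by rewrite -mulgA tperm2 mulg1.
  rewrite !inE; apply/andP; split; last first.
    by rewrite expg2 {1}cst -mulgA (mulgA s) -(expg2 s) (eqP s2) mul1g tperm2.
  apply/subsetP=> z; rewrite !inE permM => zz.
  have nzy : z != y by apply: contraNneq zz => ->; rewrite sy tpermL.
  have nzx : z != x by apply: contraNneq zz => ->; rewrite sx tpermR.
  rewrite nzy nzx /=; apply: (subsetP sA); rewrite inE; apply: contraNneq zz =>
    ->.
  by rewrite tpermD // eq_sym.
move=> /andP[hA h2] ->{s}.
have hx : h x = x by apply: (out_perm hA); rewrite !inE eqxx andbF.
have hy : h y = y by apply: (out_perm hA); rewrite !inE eqxx.
have cht : h * tperm x y = tperm x y * h by rewrite [RHS]conjgC tpermJ hx hy.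
rewrite permM hx tpermL eqxx andbT; apply/andP; split.
  apply: perm_onM.
    apply: subset_trans hA _; apply: subset_trans (subD1set _ _) (subD1set _ _).
  by apply: subset_trans (tperm_on x y) _; apply/subsetP=> z; rewrite !inE =>
    /pred2P[]->.
by rewrite expg2 {1}cht -mulgA (mulgA h) -(expg2 h) (eqP h2) mul1g tperm2.
Qed.

(** Involutions are sorted by the image of a point [x]: either it is fixed, or it is swapped with
    one of the other points. *)
Lemma card_involutions A : #|involutions A| = telephone #|A|.
Proof.
have [m] := ubnP #|A|; elim: m A => // m IHm A le_A_m.
have [->|[x Ax]] := set_0Vmem A.
  rewrite cards0 -[RHS](cards1 (1 : {perm T})); apply: eq_card => s.
  rewrite !inE; apply/andP/eqP => [[s0 _]| ->]; last by rewrite expg1n perm_on1.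
  by apply: perm_on_id s0 _; rewrite cards0.
have cA := cardsD1 x A; rewrite Ax add1n in cA; rewrite cA in le_A_m *.
rewrite -sum1_card (partition_big (fun s : {perm T} => s x) [in A]) /=;
  last first.
  by move=> s; rewrite !inE => /andP[/perm_closed-> _].
rewrite (bigD1 x) //= sum1dep_card card_involutions_fix IHm //.
rewrite (eq_bigr (fun=> telephone #|A :\ x|.-1)) => [|y /andP[Ay nyx]];
  last first.
  rewrite sum1dep_card card_involutions_swap //.
  have := cardsD1 y (A :\ x); rewrite !inE nyx Ay add1n => cAy.
  rewrite IHm; first by rewrite cAy.
  by rewrite -ltnS -cAy ltnW.
rewrite sum_nat_cond_const; have -> : #|[set y in A | y != x]| = #|A :\ x|.
  by apply: eq_card => y; rewrite !inE andbC.
by case: #|A :\ x|.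
Qed.

End Involutions.

Lemma positive_squares_Sym (F : numClosedFieldType) (T : finType) (A : {set T})
  :
  positive_squares F (Sym_group A).
Proof.
have [m] := ubnP #|A|; elim: m A => // m IHm A le_A_m.
have [->|[x Ax]] := set_0Vmem A.
  move=> n rG n_gt0; rewrite (eq_bigr (fun=> n%:R)) => [|g Gg].
    by rewrite sumr_const pmulrn_lgt0 ?ltr0n ?cardG_gt0.
  suff -> : (g ^+ 2 = 1)%g by rewrite repr_mx1 mxtrace1.
  by rewrite (@perm_on_id _ g set0) ?expg1n ?cards0 //; move: Gg; rewrite inE.
apply: (@positive_squares_step F _ _ (Sym_group (A :\ x)) (sub_Sym A x)).
- exact: Sym_inverting.
- by apply: IHm; move: le_A_m; rewrite (cardsD1 x A) Ax.
Qed.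

Lemma perm_onT (T : finType) (s : {perm T}) : perm_on setT s.
Proof. by apply/subsetP=> y _; rewrite inE. Qed.

Lemma sum_irr_degree_Sym (F : numClosedFieldType) (T : finType) (x : T)
    (sG : irrType F [set: {perm T}]) :
  (\sum_(W : sG) irr_degree W = telephone #|T|)%N.
Proof.
have sHG : Sym_group (setT :\ x) \subset [set: {perm T}]%G by apply: subsetT.
rewrite (sum_irr_degree_involutions sHG).
- rewrite -cardsT -card_involutions; apply: eq_card => s; rewrite !inE.
  by rewrite perm_onT.
- by move=> g _; apply: (@Sym_inverting _ setT); rewrite inE perm_onT.
- exact: positive_squares_Sym.
Qed.

(** * Beta-numbers and partition weights *)

Section FallingVandermonde.

Variable K : fieldType.
Implicit Types (z : K) (j n : nat).

Definition falling j z : K := \prod_(k < j) (z - k%:R).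

Lemma fallingS j z : falling j.+1 z = falling j z * (z - j%:R).
Proof. by rewrite /falling big_ord_recr. Qed.

Lemma falling_pred j z : z * falling j (z - 1) = falling j.+1 z.
Proof.
rewrite /falling big_ord_recl subr0; congr (_ * _); apply: eq_bigr => k _.
by rewrite lift0 -natr1; ring.
Qed.

Lemma falling_0 j : falling j.+1 0 = 0.
Proof. by rewrite -falling_pred mul0r. Qed.

(** A Vandermonde matrix in the basis of falling factorials, on which a unit shift of one variable
    acts simply. *)
Definition falling_mx n (x : 'I_n -> K) : 'M[K]_n :=
  \matrix_(i, j) falling j (x i).

Definition falling_det n (x : 'I_n -> K) : K := \det (falling_mx x).

Lemma eq_falling_det n (x y : 'I_n -> K) : x =1 y -> falling_det x =
  falling_det y.
Proof.
by move=> exy; congr (\det _); apply/matrixP=> i j; rewrite !mxE exy.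
Qed.

Lemma falling_det_eq0 n (x : 'I_n -> K) i1 i2 :
  i1 != i2 -> x i1 = x i2 -> falling_det x = 0.
Proof.
move=> ni e; apply: (determinant_alternate ni) => j.
by rewrite !mxE e.
Qed.

(** Cofactors along row [i] ignore that row, so [x] and [y] share them. *)
Lemma falling_det_row n (x y : 'I_n -> K) i :
    (forall k, k != i -> y k = x k) ->
  falling_det y = \sum_(j < n) falling j (y i) * cofactor (falling_mx x) i j.
Proof.
move=> exy; rewrite /falling_det (expand_det_row _ i); apply: eq_bigr => j _.
rewrite mxE; congr (_ * (_ * \det _)); apply/matrixP=> a b.
by rewrite !mxE exy // eq_sym neq_lift.
Qed.

(* [x * falling j (x - 1) = falling j x * (x - j)], so expanding along the moved
   row only scales the terms of the expansion of [falling_det x] by [x i - j]. *)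
Lemma falling_det_down n (x : 'I_n -> K) :
  \sum_i x i * falling_det (fun k => x k - (k == i)%:R) =
    (\sum_i x i - \sum_(j < n) j%:R) * falling_det x.
Proof.
pose C i (j : 'I_n) := cofactor (falling_mx x) i j.
transitivity (\sum_(i < n) \sum_(j < n) (x i * (falling j (x i) * C i j) - j%:R
  * (falling j (x i) * C i j))).
  apply: eq_bigr => i _; rewrite (@falling_det_row _ x _ i) => [|k /negPf->];
    last first.
    by rewrite subr0.
  rewrite mulr_sumr; apply: eq_bigr => j _.
  by rewrite eqxx mulrA falling_pred fallingS -/(C i j); ring.
under eq_bigr do rewrite sumrB.
rewrite sumrB mulrBl !mulr_suml; congr (_ - _).
  apply: eq_bigr => i _; rewrite -mulr_sumr; congr (_ * _).
  by rewrite (@falling_det_row _ x x i).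
rewrite exchange_big; apply: eq_bigr => j _; rewrite -mulr_sumr; congr (_ * _).
rewrite /falling_det (expand_det_col _ j); apply: eq_bigr => i _.
by rewrite mxE.
Qed.

(** Since [falling j.+1 (z + 1) / (z + 1) = falling j z], the moved row pairs column [j] with the
    cofactors of column [j.+1]; these sums vanish, and only column 0 contributes. *)
Lemma falling_det_up n (x : 'I_n.+1 -> K) k :
    x k = 0 -> (forall i, x i + 1 != 0) ->
  \sum_i falling_det (fun l => x l + (l == i)%:R) / (x i + 1) = falling_det x.
Proof.
move=> xk0 nz; pose C i (j : 'I_n.+1) := cofactor (falling_mx x) i j.
(* As [x k = 0], row [k] of the matrix is (1, 0, ..., 0). *)
have C0 i : C i ord0 = falling_det x *+ (k == i).
  have /matrixP/(_ k i) := mul_mx_adj (falling_mx x); rewrite [in RHS]mxE => <-.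
  rewrite mxE big_ord_recl big1 => [|j _]; rewrite !mxE xk0.
    by rewrite /falling big_ord0 mul1r addr0.
  by rewrite lift0 falling_0 mul0r.
transitivity (\sum_i (C i ord0 / (x i + 1) +
                \sum_(j < n) falling j (x i) * C i (lift ord0 j))).
  apply: eq_bigr => i _; rewrite (@falling_det_row _ x _ i) => [|l /negPf->];
    last first.
    by rewrite addr0.
  rewrite eqxx big_ord_recl /falling big_ord0 mul1r mulrDl mulr_suml;
    congr (_ + _).
  apply: eq_bigr => j _; rewrite -/(falling _ _) lift0 -falling_pred addrK.
  by rewrite -/(falling _ _) -/(C i _) mulrAC [_ * falling _ _]mulrC mulfK //;
    exact: nz.
rewrite big_split /= [X in _ + X]exchange_big /= [X in _ + X]big1 => [|j _];
  last first.
  have /matrixP/(_ (lift ord0 j) (widen_ord (leqnSn n) j)) :=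
    mul_adj_mx (falling_mx x).
  rewrite mxE [in RHS]mxE (_ : (_ == _) = false); last first.
    by rewrite -val_eqE /= /bump /=; lia.
  rewrite mulr0n => e0; rewrite -[RHS]e0.
  by apply: eq_bigr => i _; rewrite !mxE mulrC.
rewrite addr0 (bigD1 k) //= big1 => [|i nik]; rewrite C0; last first.
  by rewrite eq_sym (negPf nik) mul0r.
by rewrite eqxx xk0 add0r divr1 addr0.
Qed.

(* Triangular change of basis from powers to falling factorials. *)
Lemma falling_detE n (x : 'I_n -> K) :
  falling_det x = \prod_(i < n) \prod_(j < n | (i < j)%N) (x j - x i).
Proof.
pose p j : {poly K} := \prod_(k < j) ('X - k%:R%:P).
have size_p j : size (p j) = j.+1.
  by rewrite /p size_prod_XsubC /index_enum -enumT size_enum_ord.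
have pE j z : (p j).[z] = falling j z.
  by rewrite /p horner_prod; apply: eq_bigr => k _; rewrite hornerXsubC.
pose U : 'M[K]_n := \matrix_(k, j) (p j)`_k.
have defA : falling_mx x = (Vandermonde n (\row_i x i))^T *m U.
  apply/matrixP=> i j; rewrite !mxE -pE (@horner_coef_wide _ n) ?size_p //.
  by apply: eq_bigr => k _; rewrite !mxE mulrC.
rewrite /falling_det defA det_mulmx det_tr det_Vandermonde.
rewrite -[\det U]det_tr det_trig; last first.
  apply/is_trig_mxP=> i j ltij; rewrite !mxE nth_default // size_p //.
rewrite [X in _ * X]big1 => [|i _]; last first.
  rewrite !mxE; have : p i \is monic by apply: monic_prod_XsubC.
  by rewrite monicE /lead_coef size_p => /eqP.
rewrite mulr1; apply: eq_bigr => i _; apply: eq_bigr => j _; by rewrite !mxE.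
Qed.

End FallingVandermonde.

(** * Effect of adding or removing a box on the weight *)

Section Weights.

Variable n : nat.
Implicit Types (v : 'I_n.+1 -> nat) (i j : 'I_n.+1).

(** Strictly decreasing on partitions; a box move that breaks the order makes two neighbouring
    values equal. *)
Definition beta v (i : 'I_n.+1) : nat := (v i + (n - i))%N.

(* Up to the sign of [falling_det], see [weight_denominator], this is the
   inverse of the hook product of [v]. *)
Definition weight v : rat :=
  falling_det (fun i => (beta v i)%:R) / (\prod_i ((beta v i)`!)%:R).

Definition add_box v i (j : 'I_n.+1) : nat := (v j + (j == i))%N.
(** Subtraction truncates on an empty row, so sums over removals carry the condition [0 < v i]. *)
Definition del_box v i (j : 'I_n.+1) : nat := (v j - (j == i))%N.

Definition is_part v : bool :=
  [forall i : 'I_n.+1, forall j : 'I_n.+1, (i <= j)%N ==> (v j <= v i)%N].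

Lemma is_partP v :
  reflect (forall i j, (i <= j)%N -> (v j <= v i)%N) (is_part v).
Proof.
apply: (iffP forallP) => [vP i j ij | vP i].
  by have /forallP/(_ j)/implyP := vP i; apply.
by apply/forallP=> j; apply/implyP; apply: vP.
Qed.

Lemma eq_weight v w : v =1 w -> weight v = weight w.
Proof.
move=> evw; congr (_ / _); last by apply: eq_bigr => i _; rewrite /beta evw.
by apply: eq_falling_det => i; rewrite /beta evw.
Qed.

Lemma eq_is_part v w : v =1 w -> is_part v = is_part w.
Proof.
by move=> evw; apply/is_partP/is_partP=> vP i j ij; have := vP i j ij;
  rewrite !evw.
Qed.

Lemma fact_prod_neq0 v : \prod_i ((beta v i)`!)%:R != 0 :> rat.
Proof. by apply/prodf_neq0 => i _; rewrite pnatr_eq0 -lt0n fact_gt0. Qed.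

Lemma weight_eq0 v i j : i != j -> beta v i = beta v j -> weight v = 0.
Proof.
by move=> nij e; rewrite /weight (@falling_det_eq0 _ _ _ i j) ?mul0r // e.
Qed.

(** The empty last row has beta-number 0, as [falling_det_up] requires; the factorials absorb the
    division. *)
Lemma weight_add_box v : v ord_max = 0%N ->
  \sum_i weight (add_box v i) = weight v.
Proof.
move=> v0; have nz i : (beta v i)%:R + 1 != 0 :> rat by rewrite natr1 pnatr_eq0.
have b0 : (beta v ord_max)%:R = 0 :> rat by rewrite /beta v0 subnn.
rewrite [RHS]/weight -(falling_det_up b0 nz) mulr_suml; apply: eq_bigr => i _.
have bE l : beta (add_box v i) l = (beta v l + (l == i))%N.
  by rewrite /beta /add_box addnAC.
rewrite /weight -mulrA; congr (_ * _).
  by apply: eq_falling_det => l; rewrite bE natrD.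
rewrite -invfM; congr (_^-1); rewrite (bigD1 i) //= [in RHS](bigD1 i) //=.
rewrite mulrA bE eqxx addn1 factS natrM natr1; congr (_ * _).
by apply: eq_bigr => l /negPf nli; rewrite bE nli addn0.
Qed.

Lemma sum_beta v : \sum_i (beta v i)%:R = (\sum_i v i)%:R + \sum_(j < n.+1)
  j%:R :> rat.
Proof.
rewrite /beta [X in _ + X](reindex_inj rev_ord_inj) natr_sum -big_split /=.
by apply: eq_bigr => i _; rewrite natrD subSS.
Qed.

Lemma weight_del_box v : is_part v ->
  \sum_(i | (0 < v i)%N) weight (del_box v i) = (\sum_i v i)%:R * weight v.
Proof.
move=> /is_partP vP.
have -> : (\sum_i v i)%:R = \sum_i (beta v i)%:R - \sum_(j < n.+1) j%:R :> rat.
  by rewrite sum_beta addrK.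
rewrite mulrA -falling_det_down mulr_suml big_mkcond; apply: eq_bigr => i _ /=.
(* An empty row contributes nothing: its beta-number is 0 if it is the last row; otherwise the next
   row is empty too, and lowering the beta-number by one makes the two coincide. *)
have [vi0 | vi_gt0] := posnP (v i).
  suff -> : (beta v i)%:R * falling_det (fun k =>
    (beta v k)%:R - (k == i)%:R) = 0 :> rat.
    by rewrite mul0r.
  have [im|[j ij]] : i = ord_max \/ exists j : 'I_n, i = lift ord_max j.
  - by case: (unliftP ord_max i) => [j|]; [right; exists j | left].
  - by rewrite /beta vi0 im subnn mul0r.
  have {}ij : i = widen_ord (leqnSn n) j.
    by apply: val_inj; rewrite ij /= /bump leqNgt ltn_ord.
  have nij : lift ord0 j != i by rewrite ij -val_eqE /= /bump /=; lia.
  rewrite (falling_det_eq0 nij) ?mulr0 // (negPf nij) subr0 eqxx.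
  have : (v (lift ord0 j) <= v i)%N by apply: vP; rewrite ij /= /bump /=; lia.
  rewrite vi0 leqn0 => /eqP vj0; rewrite /beta vi0 vj0 ij /= /bump /= !add0n
    add1n.
  by rewrite -natrB ?subn_gt0 // subnS subn1.
have bE l : beta (del_box v i) l = (beta v l - (l == i))%N.
  by rewrite /beta /del_box; case: eqP => [->|_] /=; lia.
have b_gt0 : (0 < beta v i)%N by rewrite /beta ltn_addr.
rewrite /weight.
have -> : falling_det (fun l => (beta (del_box v i) l)%:R) =
          falling_det (fun l => (beta v l)%:R - (l == i)%:R) :> rat.
  apply: eq_falling_det => l; rewrite bE natrB //.
  by case: eqP => [->|].
have -> : \prod_l ((beta v l)`!)%:R =
   (beta v i)%:R * \prod_l ((beta (del_box v i) l)`!)%:R :> rat.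
  rewrite (bigD1 i) //= [in RHS](bigD1 i) //= mulrA bE eqxx -natrM subn1.
  rewrite -[in RHS](prednK b_gt0) /= -factS prednK //; congr (_ * _).
  by apply: eq_bigr => l /negPf nli; rewrite bE nli subn0.
by field; rewrite fact_prod_neq0 pnatr_eq0 -lt0n.
Qed.

Lemma is_part_add_box0 v : is_part v -> is_part (add_box v ord0).
Proof.
move=> /is_partP vP; apply/is_partP=> a b ab; rewrite /add_box leq_add ?vP //.
by case: (eqVneq b ord0) ab => [->|//]; rewrite leqn0 -val_eqE /= => ->.
Qed.

Lemma is_part_add_boxS v (i : 'I_n) : is_part v ->
  is_part (add_box v (lift ord0 i)) =
    (v (lift ord0 i) < v (widen_ord (leqnSn n) i))%N.
Proof.
move=> /is_partP vP; apply/is_partP/idP => [aP | lt_v a b ab].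
  have := aP (widen_ord (leqnSn n) i) (lift ord0 i).
  rewrite /add_box eqxx -val_eqE /= /bump /=; lia.
rewrite /add_box; have := vP _ _ ab.
case: (eqVneq b _) => [eb|_]; last by lia.
case: (eqVneq a _) => [ea|na]; first by lia.
subst b; have := vP a (widen_ord (leqnSn n) i).
by move: na ab; rewrite -val_eqE /= /bump /=; lia.
Qed.

Lemma is_part_del_boxS v (i : 'I_n) : is_part v ->
  let i' := widen_ord (leqnSn n) i in
  (0 < v i')%N && is_part (del_box v i') = (v (lift ord0 i) < v i')%N.
Proof.
move=> /is_partP vP i'; apply/andP/idP => [[v_gt0 /is_partP dP] | lt_v].
  have := dP i' (lift ord0 i).
  rewrite /del_box eqxx -val_eqE /= /bump /=; lia.
split; first by lia.
apply/is_partP => a b ab; rewrite /del_box; have := vP _ _ ab.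
case: (eqVneq a _) => [ea|_]; last by lia.
case: (eqVneq b _) => [eb|nb]; first by lia.
subst a; have := vP (lift ord0 i) b.
by move: nb ab; rewrite -val_eqE /= /bump /=; lia.
Qed.

Lemma weight_add_box_eq0 v i :
  is_part v -> ~~ is_part (add_box v i) -> weight (add_box v i) = 0.
Proof.
move=> vP; have [->|[j ->]] : i = ord0 \/ exists j : 'I_n, i = lift ord0 j.
- by case: (unliftP ord0 i) => [j|]; [right; exists j | left].
- by rewrite is_part_add_box0.
rewrite is_part_add_boxS // -leqNgt => le_v.
apply: (@weight_eq0 _ (lift ord0 j) (widen_ord (leqnSn n) j)).
  by rewrite -val_eqE /= /bump /=; lia.
have := is_partP _ vP (widen_ord (leqnSn n) j) (lift ord0 j) (leqnSn j).
move: le_v; rewrite /beta /add_box eqxx -val_eqE /= /bump /= add1n.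
by rewrite (ltn_eqF (ltnSn j)); have := ltn_ord j; lia.
Qed.

Lemma weight_del_box_eq0 v i : is_part v -> (0 < v i)%N ->
  ~~ is_part (del_box v i) -> weight (del_box v i) = 0.
Proof.
move=> vP v_gt0 dP.
have [im|[j ij]] : i = ord_max \/ exists j : 'I_n, i = lift ord_max j.
- by case: (unliftP ord_max i) => [j|]; [right; exists j | left].
- case/negP: dP; apply/is_partP => a b ab; rewrite /del_box.
  have := is_partP _ vP _ _ ab; case: (eqVneq a _) => [ea|_]; last by lia.
  have -> : b = i by apply/val_inj/eqP; rewrite eqn_leq -{2}ea ab andbT im
    leq_ord.
  by rewrite ea eqxx.
have {}ij : i = widen_ord (leqnSn n) j.
  by apply: val_inj; rewrite ij /= /bump leqNgt ltn_ord.
have := is_part_del_boxS j vP; rewrite -ij /= (negPf dP) andbF => /esym/negbT.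
rewrite -leqNgt => le_v.
apply: (@weight_eq0 _ (lift ord0 j) i).
  by rewrite ij -val_eqE /= /bump /=; lia.
have := is_partP _ vP i (lift ord0 j).
rewrite {1}ij => /(_ (leqnSn j)).
move: le_v; rewrite /beta /del_box eqxx ij -val_eqE /= /bump /= add1n.
by rewrite (gtn_eqF (ltnSn j)) -ij; have := ltn_ord j; lia.
Qed.

(** Row [i + 1] accepts a box exactly when row [i] can lose one; the first row always accepts, and
    the empty last row can lose none. *)
Lemma card_add_del_box v : is_part v -> v ord_max = 0%N ->
  (\sum_i is_part (add_box v i) =
   (\sum_i ((0 < v i)%N && is_part (del_box v i))).+1)%N.
Proof.
move=> vP v0; rewrite big_ord_recl is_part_add_box0 // add1n; congr _.+1.
rewrite big_ord_recr /= v0 ltnn /= addn0; apply: eq_bigr => i _.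
by rewrite is_part_add_boxS // is_part_del_boxS.
Qed.

End Weights.

(** * Partitions as bounded tuples, and the recursion for weight sums *)

Section PartitionTuples.

Variable n : nat.
Local Notation tup := (n.+1.-tuple 'I_n.+2).
Implicit Types (t : tup) (i j : 'I_n.+1).

Definition part_val t i : nat := tnth t i.

(** The size [k] is independent of [n], so that the recursion on [k] stays within one finite
    type. *)
Definition is_partn k t : bool :=
  is_part (part_val t) && (\sum_i part_val t i == k)%N.

(** [inord] falls back to [ord0] out of range, whence the bound in [part_val_up]. *)
Definition up i t : tup := [tuple inord (add_box (part_val t) i j) | j < n.+1].
Definition down i t : tup := [tuple inord (del_box (part_val t) i j) | j <
  n.+1].

Lemma part_val_inj t t' : part_val t =1 part_val t' -> t = t'.
Proof. by move=> e; apply: eq_from_tnth => i; apply: val_inj; apply: e. Qed.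

Lemma part_val_down i t : part_val (down i t) =1 del_box (part_val t) i.
Proof.
move=> j; rewrite /part_val tnth_mktuple inordK // /del_box.
exact: leq_ltn_trans (leq_subr _ _) (ltn_ord _).
Qed.

Lemma part_val_up i t : (part_val t i <= n)%N ->
  part_val (up i t) =1 add_box (part_val t) i.
Proof.
move=> le_n j; rewrite /part_val tnth_mktuple inordK // /add_box.
by case: eqP => [->|_]; rewrite ?addn1 ?addn0 ?ltn_ord.
Qed.

Lemma is_partn_le k t i : is_partn k t -> (part_val t i <= k)%N.
Proof. by case/andP=> _ /eqP <-; rewrite (bigD1 i) //= leq_addr. Qed.

Lemma is_partn_last0 k t : (k <= n)%N -> is_partn k t -> part_val t ord_max =
  0%N.
Proof.
move=> le_kn /andP[/is_partP tP /eqP sum_t]; apply/eqP; apply: contraLR le_kn.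
rewrite -lt0n => t_gt0; rewrite -ltnNge -sum_t -[X in (X <= _)%N]card_ord
  -sum1_card.
by apply: leq_sum => i _; exact: (leq_trans t_gt0 (tP i ord_max (leq_ord i))).
Qed.

Lemma sum_add_box (v : 'I_n.+1 -> nat) i :
  (\sum_j add_box v i j = (\sum_j v j).+1)%N.
Proof.
rewrite /add_box big_split /= (bigD1 i) // [X in (_ + X)%N](bigD1 i) //= eqxx.
by rewrite [X in (_ + (1 + X))%N]big1 ?addn1 // => j /negPf->.
Qed.

Lemma del_add_box (v : 'I_n.+1 -> nat) i : del_box (add_box v i) i =1 v.
Proof. by move=> j; rewrite /del_box /add_box addnK. Qed.

Lemma add_del_box (v : 'I_n.+1 -> nat) i : (0 < v i)%N -> add_box (del_box v i)
  i =1 v.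
Proof.
by move=> v_gt0 j; rewrite /del_box /add_box; case: eqP => [->|_];
  rewrite ?subnK // subn0 addn0.
Qed.

(** Double counting of pairs of partitions differing by one box; [phi] takes the larger one
    first. *)
Lemma box_exchange (phi : tup -> tup -> rat) k : (k <= n)%N ->
  \sum_(t | is_partn k.+1 t)
     \sum_(i | (0 < part_val t i)%N && is_part (del_box (part_val t) i)) phi t
       (down i t)
  = \sum_(t | is_partn k t)
     \sum_(i | is_part (add_box (part_val t) i)) phi (up i t) t.
Proof.
move=> le_kn; rewrite !pair_big_dep /=.
rewrite (reindex_onto (fun p => (up p.2 p.1, p.2)) (fun p =>
  (down p.2 p.1, p.2))) /=.
  apply: eq_big => [[t i]|[t i] /andP[_ /eqP[->]] //] /=.
  apply/idP/idP => [/andP[/andP[/andP[uP sum_u] /andP[u_gt0 dP]] /eqP[dt]]|].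
    have tE : part_val t =1 del_box (part_val (up i t)) i.
      by move=> j; rewrite -{1}dt part_val_down.
    have aE : add_box (part_val t) i =1 part_val (up i t).
      by move=> j; rewrite -(add_del_box u_gt0 j) /add_box tE.
    rewrite /is_partn (eq_is_part tE) dP (eq_is_part aE) uP andbT /=.
    by rewrite -eqSS -(sum_add_box _ i) (eq_bigr _ (fun j _ => aE j)).
  case/andP=> kt aP; have [tP sum_t] := andP kt.
  have uE := part_val_up (leq_trans (is_partn_le i kt) le_kn).
  have dE : del_box (part_val (up i t)) i =1 part_val t.
    by move=> j; rewrite /del_box uE -/(del_box _ _ _) del_add_box.
  rewrite /is_partn (eq_is_part uE) aP (eq_bigr _ (fun j _ =>
    uE j)) sum_add_box eqSS sum_t.
  rewrite (eq_is_part dE) tP uE /add_box eqxx addn1 /=.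
  by apply/eqP; congr (_, _); apply: part_val_inj => j;
    rewrite part_val_down dE.
move=> [t i] /= /andP[kt /andP[t_gt0 dP]]; congr (_, _).
apply: part_val_inj => j; rewrite part_val_up; last first.
  rewrite part_val_down /del_box eqxx leq_subLR add1n.
  exact: leq_ord.
by rewrite /add_box part_val_down -/(add_box _ _ _) add_del_box.
Qed.

Definition weight_sum k : rat := \sum_(t | is_partn k t) weight (part_val t).

Lemma weight_sum_rec k : (k <= n)%N ->
  k.+1%:R * weight_sum k.+1 =
    weight_sum k + (if k is k'.+1 then weight_sum k' else 0).
Proof.
move=> le_kn.
transitivity (\sum_(t | is_partn k.+1 t)
     \sum_(i | (0 < part_val t i)%N && is_part (del_box (part_val t) i))
        weight (part_val (down i t))).
  rewrite mulr_sumr; apply: eq_bigr => t /andP[tP /eqP sum_t].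
  rewrite -sum_t -weight_del_box // big_mkcondr; apply: eq_bigr => i ti_gt0.
  case: ifPn => [_|dP]; last exact: weight_del_box_eq0.
  by apply: eq_weight => j; rewrite part_val_down.
rewrite (box_exchange (fun _ t => weight (part_val t))) //.
(* Each [t] is counted once per addable box, that is once more than per removable box. *)
transitivity (\sum_(t | is_partn k t) (weight (part_val t) +
    \sum_(i | (0 < part_val t i)%N && is_part (del_box (part_val t) i)) weight
      (part_val t))).
  apply: eq_bigr => t kt; have [tP _] := andP kt.
  have sum_cond (P : pred 'I_n.+1) (w : rat) : \sum_(i | P i) w = w *+ \sum_i P
    i.
    by rewrite -sumrMnr big_mkcond; apply: eq_bigr => i _; case: (P i).
  by rewrite !sum_cond card_add_del_box ?mulrS // (is_partn_last0 le_kn).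
rewrite big_split /=; congr (_ + _); case: k le_kn => [|k] le_kn.
  apply: big1 => t t0; apply: big1 => i /andP[].
  by rewrite ltnNge is_partn_le.
(* Exchanging one size lower reduces the remaining sum to [weight_add_box]. *)
rewrite (box_exchange (fun t _ => weight (part_val t))) ?(ltnW le_kn) //.
apply: eq_bigr => t kt; have [tP _] := andP kt.
have t0 : part_val t ord_max = 0%N by apply: is_partn_last0 kt; apply: ltnW.
rewrite -(weight_add_box t0) big_mkcond; apply: eq_bigr => i _.
case: ifPn => [_|aP]; last by rewrite weight_add_box_eq0.
apply: eq_weight => j; apply: part_val_up.
exact: leq_trans (is_partn_le i kt) (ltnW le_kn).
Qed.

End PartitionTuples.

(** * The hook product *)

Section Hooks.

Local Open Scope nat_scope.

(** Both sides are the product of the integers from [a - x + r.+1] to [a + r.+1]. *)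
Lemma prod_arm_shift a r x : x <= a ->
  (\prod_(1 <= j < x.+1) (a - j + 1 + r.+1)) * (a - x + r.+1) =
  (\prod_(1 <= j < x.+1) (a - j + 1 + r)) * (a + r.+1).
Proof.
elim: x => [|x IHx] le_xa; first by rewrite !big_geq // subn0.
rewrite !(big_nat_recr _ _ _ (ltn0Sn x)) /=.
have -> : a - x.+1 + 1 + r.+1 = a - x + r.+1 by lia.
have -> : a - x.+1 + 1 + r = a - x.+1 + r.+1 by lia.
by rewrite IHx ?(ltnW le_xa) // mulnAC.
Qed.

(** The hook lengths of a row of length [a] above rows [b] are complementary in 1, ..., [a + r] to
    the differences of beta-numbers. Induction on the number of rows below. *)
Lemma row_hook_prod a (b : nat -> nat) r :
    (forall i j, i <= j < r -> b j <= b i) -> (forall i, i < r -> b i <= a) ->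
  (\prod_(1 <= j < a.+1) (a - j + 1 + \sum_(k < r) (j <= b k))) *
  (\prod_(k < r) (a - b k + k.+1)) = (a + r)`!.
Proof.
elim: r => [_ _|r IHr b_dec b_le].
  rewrite big_ord0 muln1 addn0 fact_prod big_nat_rev /=.
  by apply: eq_big_nat => j; rewrite big_ord0; lia.
have le_xa : b r <= a by apply: b_le.
have {}IHr : \prod_(1 <= j < a.+1) (a - j + 1 + \sum_(k < r) (j <= b k)) *
    \prod_(k < r) (a - b k + k.+1) = (a + r)`!.
  apply: IHr => [i j /andP[ij jr]|i ir]; last by apply/b_le/ltnW.
  by apply: b_dec; rewrite ij ltnW.
(* The new row lengthens the legs only in columns [j <= b r], where every earlier row is already
   counted, so the leg grows from [r] to [r.+1]. *)
have cutP (F : nat -> nat) : \prod_(1 <= j < a.+1) F j =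
    \prod_(1 <= j < (b r).+1) F j * \prod_((b r).+1 <= j < a.+1) F j.
  by rewrite -big_cat_nat.
have sum_r j : j <= b r -> \sum_(k < r) (j <= b k) = r.
  move=> jx; rewrite -[RHS]card_ord -sum1_card; apply: eq_bigr => k _.
  by rewrite (leq_trans jx) // b_dec // ltnW //=.
rewrite cutP [X in _ * X = _]big_ord_recr /= [in RHS]addnS factS -IHr [in
  RHS]cutP.
set A' := \prod_(1 <= j < _) _; set B' := \prod_(_ <= j < _) _.
set A := \prod_(1 <= j < _) _; set B := \prod_(_ <= j < _) _.
have -> : B' = B.
  apply: eq_big_nat => j /andP[xj _].
  by rewrite big_ord_recr /= [j <= b r]leqNgt xj addn0.
have : A' * (a - b r + r.+1) = A * (a + r.+1).
  rewrite -[A * _](_ : \prod_(1 <= j < (b r).+1) (a - j + 1 + r) * (a + r.+1) =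
    _).
    rewrite -prod_arm_shift //; congr (_ * _); apply: eq_big_nat =>
      j /andP[_ jx].
    have {}jx : j <= b r := jx.
    by rewrite big_ord_recr /= sum_r // jx (addn1 r).
  by rewrite /A; congr (_ * _); apply: eq_big_nat => j /andP[_ jx];
    rewrite sum_r.
move: (\prod_(k < r) _) => Q e.
rewrite (_ : _ * _ = A' * (a - b r + r.+1) * B * Q); last by ring.
by rewrite e addnS; ring.
Qed.

Section Rows.

Variables (n : nat) (t : n.-tuple 'I_n.+1).
Hypothesis t_dec : forall i j, 0 < i <= j -> entry t j <= entry t i.

Lemma entry_gt0_le_delta l : l <= n -> 0 < entry t l -> l <= delta t.
Proof.
move=> le_ln t_gt0; rewrite /delta (@big_cat_nat _ _ _ l.+1) //=.
apply: leq_trans (leq_addr _ _).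
rewrite (@eq_big_nat _ _ _ _ _ _ (fun=> 1)) => [|k /andP[k_gt0 kl]].
  by rewrite sum_nat_const_nat subn1 muln1.
by rewrite /Lambda (leq_trans t_gt0) // t_dec // k_gt0.
Qed.

Lemma delta_le : delta t <= n.
Proof.
rewrite -[X in _ <= X](subn1 n.+1) -[X in _ <= X]muln1 -sum_nat_const_nat.
by apply: leq_sum => k _; rewrite leq_b1.
Qed.

Definition row_hooks l := \prod_(1 <= j < (entry t l).+1) (entry t l - j + 1 +
  Gamma t j l).

(** Rows beyond [delta t] are empty and have hook product 1. *)
Lemma denominator_rows : denominator t = \prod_(i < n) row_hooks i.+1.
Proof.
transitivity (\prod_(1 <= l < n.+1) row_hooks l);
  last by rewrite big_add1 big_mkord.
rewrite [RHS](@big_cat_nat _ _ _ (delta t).+1) //=;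
  last by rewrite ltnS delta_le.
rewrite [X in _ * X]big1_seq ?muln1 // => l /andP[_]; rewrite mem_index_iota.
case/andP=> lt_dl le_ln; rewrite /row_hooks (_ : entry t l = 0) ?big_geq //.
apply/eqP; rewrite -leqn0 leqNgt; apply: contraL lt_dl => t_gt0.
by rewrite -leqNgt entry_gt0_le_delta.
Qed.

Lemma row_hooks_prod (i : 'I_n) :
  row_hooks i.+1 * \prod_(j < n | i < j) (entry t i.+1 - entry t j.+1 + (j -
    i)) =
  (entry t i.+1 + (n - i.+1))`!.
Proof.
(* [entry] is 1-based: below row [i.+1] come the rows from [i.+2] on. *)
rewrite -(@row_hook_prod _ (fun k => entry t (k + i.+2)) (n - i.+1));
  first last.
- by move=> k _; rewrite t_dec //=; lia.
- by move=> k l /andP[kl _]; rewrite t_dec //= leq_add2r; lia.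
congr (_ * _).
  apply: eq_bigr => j _; rewrite /Gamma -{1}[i.+2]add0n big_addn.
  by rewrite big_mkord subSS; congr (_ + _); apply: eq_bigr.
rewrite -(big_geq_mkord i.+1 n xpredT (fun j =>
  entry t i.+1 - entry t j.+1 + (j - i))).
rewrite -[X in \prod_(X <= _ < _) _]add0n big_addn big_mkord.
by apply: eq_bigr => k _; rewrite -addnS; congr (_ + _); lia.
Qed.

End Rows.

End Hooks.

(** * From weights to the hook sum *)

Section HookSum.

Variable n : nat.
Local Notation tup := (n.+1.-tuple 'I_n.+2).
Implicit Types (t : tup).

Lemma entryE t (i : 'I_n.+1) : entry t i.+1 = part_val t i.
Proof.
by rewrite /entry (nth_map ord0) ?size_tuple //= /part_val (tnth_nth ord0).
Qed.

Lemma entry_default t k : (n.+1 < k)%N -> entry t k = 0%N.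
Proof. by case: k => // k lt_nk; rewrite /entry nth_default // size_map
  size_tuple. Qed.

Lemma entry_dec t : is_part (part_val t) ->
  forall i j, (0 < i <= j)%N -> (entry t j <= entry t i)%N.
Proof.
move=> /is_partP tP [|i] [|j] // /andP[_]; rewrite ltnS => le_ij.
have [lt_j|le_j] := ltnP j n.+1; last by rewrite [entry t j.+1]entry_default.
have lt_i := leq_ltn_trans le_ij lt_j.
by rewrite (entryE t (Ordinal lt_i)) (entryE t (Ordinal lt_j)); apply: tP.
Qed.

(** [falling_detE] takes later minus earlier values, all negative because beta-numbers decrease. *)
Definition weight_sign : rat := \prod_(i < n.+1) \prod_(j < n.+1 | (i < j)%N)
  (-1).

Lemma weight_signK : weight_sign * weight_sign = 1.
Proof.
rewrite /weight_sign -big_split big1 // => i _.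
by rewrite -big_split big1 // => j _; rewrite mulrNN mulr1.
Qed.

(** Multiplying [row_hooks_prod] over all rows gives the beta factorials as hooks times [gaps]; the
    latter cancel against the Vandermonde product. *)
Lemma weight_denominator t : is_part (part_val t) ->
  weight (part_val t) = weight_sign / (denominator t)%:R.
Proof.
move=> tP; have t_dec := entry_dec tP.
pose gaps := (\prod_(i < n.+1) \prod_(j < n.+1 | i < j)
                (entry t i.+1 - entry t j.+1 + (j - i)))%N.
have betas : (\prod_i (beta (part_val t) i)`! = denominator t * gaps)%N.
  rewrite denominator_rows // -big_split; apply: eq_bigr => i _ /=.
  by rewrite row_hooks_prod // entryE.
have dets : falling_det (fun i => (beta (part_val t) i)%:R) = weight_sign *
  gaps%:R.
  rewrite falling_detE natr_prod -big_split; apply: eq_bigr => i _ /=.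
  rewrite natr_prod -big_split; apply: eq_bigr => j lt_ij /=.
  rewrite mulN1r; have := t_dec i.+1 j.+1 (ltnW lt_ij : 0 < i.+1 <= j.+1)%N.
  have := ltn_ord j; move: lt_ij; rewrite !entryE /beta => lt_ij lt_jn le_t.
  rewrite -opprB -natrB; last by lia.
  by congr (- _%:R); lia.
have gaps_neq0 : gaps%:R != 0 :> rat.
  rewrite pnatr_eq0 -lt0n; have : (0 < denominator t * gaps)%N.
    by rewrite -betas prodn_gt0 // => i; rewrite fact_gt0.
  by rewrite muln_gt0 => /andP[].
by rewrite /weight dets -natr_prod betas natrM -mulf_div divff // mulr1.
Qed.

Lemma part_sum_weight k :
  \sum_(t : tup | is_partn k t) (k`!)%:R / (denominator t)%:R =
    (k`!)%:R * weight_sign * weight_sum n k.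
Proof.
rewrite mulr_sumr; apply: eq_bigr => t /andP[tP _].
by rewrite weight_denominator // mulrA -[_ * _ * weight_sign]mulrA weight_signK
  mulr1.
Qed.

Lemma weight_sum0 : weight_sum n 0 = weight_sign.
Proof.
pose t0 : tup := [tuple ord0 | _ < n.+1].
have t0E i : part_val t0 i = 0%N by rewrite /part_val tnth_mktuple.
have t0P : is_part (part_val t0) by apply/is_partP=> i j _; rewrite !t0E.
rewrite /weight_sum (big_pred1 t0) => [|t]; last first.
  apply/idP/eqP => [t_0|->]; last first.
    by rewrite /is_partn t0P big1.
  apply: part_val_inj => i; rewrite t0E; apply/eqP.
  by rewrite -leqn0 is_partn_le.
rewrite weight_denominator // denominator_rows ?big1 ?divr1 //;
  last exact: entry_dec.
by move=> i _; rewrite /row_hooks entryE t0E big_geq.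
Qed.

Lemma telephone_weight_sum k : (k <= n.+1)%N ->
  (telephone k)%:R = (k`!)%:R * weight_sign * weight_sum n k.
Proof.
elim/ltn_ind: k => -[|[|k]] IHk le_kn.
- by rewrite weight_sum0 -mulrA weight_signK.
- have := @weight_sum_rec n 0 isT; rewrite weight_sum0 addr0 mul1r => ->.
  by rewrite -mulrA weight_signK mulr1.
have rec := @weight_sum_rec n k.+1 le_kn.
have -> : telephone k.+2 = (telephone k.+1 + k.+1 * telephone k)%N by [].
have := IHk k.+1 (ltnSn _) (ltnW le_kn); have :=
  IHk k (ltnW (ltnSn _)) (ltnW (ltnW le_kn)).
move: (telephone k) (telephone k.+1) => T0 T1 eT0 eT1.
rewrite natrD natrM eT0 eT1.
(* The factor [k.+2] is split off the factorial to match [weight_sum_rec]. *)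
have -> : (k.+2)`!%:R * weight_sign * weight_sum n k.+2 =
    (k.+1)`!%:R * weight_sign * (k.+2%:R * weight_sum n k.+2).
  by rewrite factS natrM; ring.
by rewrite rec factS natrM; ring.
Qed.

Lemma admissible_is_partn t :
  admissible t = is_partn n.+1 t && (entry t 1 < n.+1)%N.
Proof.
rewrite /admissible /is_partn big_add1 big_mkord (eq_bigr (part_val t));
  last first.
  by move=> i _; rewrite entryE.
rewrite andbA -[RHS]andbA [RHS]andbC; congr (_ && _ && _).
apply/forallP/idP => [tP|/entry_dec tP k]; last first.
  by apply/implyP => k_gt0; rewrite tP // k_gt0 leqnSn.
apply/is_partP => i j le_ij; rewrite -!entryE -(subnKC le_ij).
have : (i + (j - i) < n.+1)%N by rewrite subnKC.
(* Comparisons of neighbours are chained by induction on the distance. *)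
elim: (j - i)%N => [|d IHd] lt_d; first by rewrite addn0.
apply: leq_trans (IHd _); last by apply: ltn_trans lt_d; rewrite addnS.
have := tP (Ordinal lt_d); rewrite /= addnS; exact.
Qed.

(** The only partition left out by admissibility is the single row, with hook product [(n.+1)!]; it
    accounts for the leading 1 of the formula. *)
Lemma one_row_sum :
  \sum_(t : tup | is_partn n.+1 t && ~~ (entry t 1 < n.+1)%N)
     ((n.+1)`!)%:R / (denominator t)%:R = 1 :> rat.
Proof.
pose t1 : tup := [tuple if j == ord0 then ord_max else ord0 | j < n.+1].
have t1E i : part_val t1 i = if i == ord0 then n.+1 else 0%N.
  by rewrite /part_val tnth_mktuple; case: ifP.
have t1P : is_part (part_val t1).
  apply/is_partP=> i j le_ij; rewrite !t1E; case: (eqVneq j ord0) => // j0.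
  by move: le_ij; rewrite j0 leqn0 -val_eqE /= => ->.
have entry1 : entry t1 1 = n.+1 by rewrite (entryE t1 ord0) t1E eqxx.
rewrite (big_pred1 t1) => [|t]; last first.
  apply/andP/eqP => [[t_n]|->]; last first.
    rewrite /is_partn t1P entry1 ltnn big_ord_recl t1E eqxx big1 => [|i _];
      last by rewrite t1E.
    by rewrite addn0 eqxx.
  rewrite (entryE t ord0) -leqNgt => le_t0; have [_ sum_t] := andP t_n.
  have t0 : part_val t ord0 = n.+1.
    by apply/eqP; rewrite eqn_leq le_t0 andbT is_partn_le.
  apply: part_val_inj => i; rewrite t1E; case: (eqVneq i ord0) => [->//|ni].
  move: sum_t; rewrite (bigD1 ord0) //= t0 -[X in _ == X]addn0 eqn_add2l.
  by rewrite sum_nat_eq0 => /forallP/(_ i)/implyP/(_ ni)/eqP.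
suff -> : denominator t1 = (n.+1)`! by rewrite divff // pnatr_eq0 -lt0n
  fact_gt0.
rewrite (denominator_rows (entry_dec t1P)) big_ord_recl big1 ?muln1; last first.
  by move=> i _; rewrite /row_hooks entryE t1E big_geq.
rewrite /row_hooks entry1 -[n.+1 in RHS]addn0.
rewrite -(@row_hook_prod n.+1 (fun=> 0%N) 0) // big_ord0 muln1.
apply: eq_big_nat => j /andP[j_gt0 _]; rewrite big_ord0 /Gamma big1_seq // =>
  k /andP[_].
rewrite mem_index_iota => /andP[k_gt1 lt_k].
case: k k_gt1 lt_k => // k k_gt0; rewrite ltnS => lt_k.
rewrite /Omega (entryE t1 (Ordinal lt_k)) t1E -val_eqE /= gtn_eqF //.
by rewrite leqNgt j_gt0.
Qed.

End HookSum.

(** * Comparison of the degree sum with the hook sum *)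

Lemma irr_degree_sum_S (R : realType) (n : nat) (hn : (1 <= n)%N) :
  irr_degree_sum R[i] [set: 'S_n]%G = telephone n.
Proof.
case: n hn => // n _; rewrite -[in RHS](card_ord n.+1).
exact: (@sum_irr_degree_Sym R[i] _ ord0).
Qed.

Theorem theorem3p9 (R : realType) (n : nat) (hn : (1 <= n)%N) :
  (irr_degree_sum R[i] [set: 'S_n]%G)%:R
  = 1 + \sum_(t : n.-tuple 'I_n.+1 | admissible t)
          (n`!)%:R / (denominator t)%:R :> rat.
Proof.
rewrite irr_degree_sum_S //; case: n hn => // n _.
rewrite (@telephone_weight_sum n n.+1) // -part_sum_weight.
rewrite (bigID (fun t => (entry t 1 < n.+1)%N)) /= one_row_sum addrC;
  congr (_ + _).
by apply: eq_bigl => t; rewrite admissible_is_partn.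
Qed.
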